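(* Let $n\ge1$ be an integer and $f\in C([-1,1]^3)$. Let $\nu$, $\mu$, $\{\theta_s\}$, $\{\omega_s\}$, $\{w_s\}$ be given by either of the two choices (i), (ii) described in the context, and let $C_{i,j,k}$ be the hyperinterpolation coefficients of $f$, $$ C_{i,j,k}=\sum_{s=0}^{\mu}w_s\,f(\boldsymbol{\ell}_n(\theta_s))\,\hat\phi_{i,j,k}(\boldsymbol{\ell}_n(\theta_s)),\qquad i,j,k\ge0,\ i+j+k\le n . $$ Then, for all integers $i,j,k\ge 0$ with $i+j+k\le n$, $$ C_{i,j,k}=\frac{\pi^2}{4}\,\sigma_{ia_n}\sigma_{jb_n}\sigma_{kc_n}\left(\frac{\gamma_{\alpha_1}}{\sigma_{\alpha_1}}+\frac{\gamma_{\alpha_2}}{\sigma_{\alpha_2}}+\frac{\gamma_{\alpha_3}}{\sigma_{\alpha_3}}+\frac{\gamma_{\alpha_4}}{\sigma_{\alpha_4}}\right), $$ where $$ \alpha_1=ia_n+jb_n+kc_n,\quad \alpha_2=|ia_n+jb_n-kc_n|,\quad \alpha_3=|ia_n-jb_n|+kc_n,\quad \alpha_4=\bigl||ia_n-jb_n|-kc_n\bigr|, $$ and $\{\gamma_m\}$ are the first $\nu+1$ coefficients of the discretized Chebyshev expansion of $t\mapsto f(T_{a_n}(t),T_{b_n}(t),T_{c_n}(t))$, $t\in[-1,1]$, namely $$ \gamma_m=\sum_{s=0}^{\mu}\omega_s\,\hat T_m(\tau_s)\,f(T_{a_n}(\tau_s),T_{b_n}(\tau_s),T_{c_n}(\tau_s)),\qquad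 m=0,1,\dots,\nu, $$ with $\tau_s=\cos(\theta_s)$, $s=0,1,\dots,\mu$.
   Context: For each integer $n\ge1$, the integer triple $(a_n,b_n,c_n)$ is $$ (a_n,b_n,c_n)=\begin{cases} \left(\frac{3}{4}n^2+\frac{1}{2}n,\ \frac{3}{4}n^2+n,\ \frac{3}{4}n^2+\frac{3}{2}n+1\right), & n \text{ even},\\[4pt] \left(\frac{3}{4}n^2+\frac{1}{4},\ \frac{3}{4}n^2+\frac{3}{2}n-\frac{1}{4},\ \frac{3}{4}n^2+\frac{3}{2}n+\frac{3}{4}\right), & n \text{ odd}, \end{cases} $$ and the Lissajous curve is $\boldsymbol{\ell}_n(\theta)=(\cos(a_n\theta),\cos(b_n\theta),\cos(c_n\theta))$, $\theta\in[0,\pi]$. $T_m(t)=\cos(m\arccos t)$ is the Chebyshev polynomial of degree $m$ on $[-1,1]$, and the normalized Chebyshev polynomial is $\hat T_m=\sigma_m T_m$ with $$\sigma_m=\sqrt{\frac{1+\mathrm{sign}(m)}{\pi}},\quad m\ge0,\qquad \mathrm{sign}(0)=0.$$ The trivariate basis is $\hat\phi_{i,j,k}(\boldsymbol{x})=\hat T_i(x_1)\hat T_j(x_2)\hat T_k(x_3)$, $i,j,k\ge0$, $i+j+k\le n$. Put $\nu=n\max\{a_n,b_n,c_n\}$ and $w_s=\pi^2\omega_s$ for $s=0,\dots,\mu$, where one of the following two choices is made: (i) $\mu=\nu$, $\theta_s=\frac{(2s+1)\pi}{2\mu+2}$, $\omega_s=\frac{\pi}{\mu+1}$, $s=0,\dots,\mu$;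 (ii) $\mu=\nu+1$, $\theta_s=\frac{s\pi}{\mu}$, $s=0,\dots,\mu$, with $\omega_0=\omega_\mu=\frac{\pi}{2\mu}$ and $\omega_s=\frac{\pi}{\mu}$ for $s=1,\dots,\mu-1$. *)

(* Defs.v *)
From HB Require Import structures.
From mathcomp Require Import all_boot all_order all_algebra.
From mathcomp Require Import all_classical all_reals all_analysis.
From mathcomp Require Import ring zify.

Set Implicit Arguments.
Unset Strict Implicit.
Unset Printing Implicit Defensive.

Import Order.TTheory GRing.Theory Num.Theory.
Import numFieldNormedType.Exports.

Local Open Scope ring_scope.
Local Open Scope classical_set_scope.

(* The frequencies are integers given by formulas with denominator 4: all the
   divisions below are exact, and lissaE, lissbE and lisscE recover the
   formulas with rational coefficients. *)
Definition lissa (n : nat) : nat :=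
  (if odd n then (3 * n ^ 2 + 1) %/ 4 else (3 * n ^ 2 + 2 * n) %/ 4)%N.

Definition lissb (n : nat) : nat :=
  (if odd n then (3 * n ^ 2 + 6 * n - 1) %/ 4
   else (3 * n ^ 2 + 4 * n) %/ 4)%N.

Definition lissc (n : nat) : nat :=
  (if odd n then (3 * n ^ 2 + 6 * n + 3) %/ 4
   else (3 * n ^ 2 + 6 * n + 4) %/ 4)%N.

Lemma natr_eq_div4 (F : numFieldType) (m : nat) (x : F) :
  4 * x = (m * 4)%N%:R -> m%:R = x.
Proof.
move=> h; apply: (@mulfI F 4); first by rewrite pnatr_eq0.
by rewrite h natrM mulrC.
Qed.

Lemma lissaE (F : numFieldType) (n : nat) : (lissa n)%:R =
  (if odd n then 3 / 4 * n%:R ^+ 2 + 1 / 4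
   else 3 / 4 * n%:R ^+ 2 + 1 / 2 * n%:R) :> F.
Proof.
rewrite /lissa; have := odd_double_half n; case: ifP => _ /= <-;
  rewrite -!mul2n -!mulnn; move: n./2 => m; apply: natr_eq_div4; rewrite divnK.
- by rewrite !(natrD, natrM); field.
- by apply/dvdnP; exists (3 * m * m + 3 * m + 1)%N; ring.
- by rewrite !(natrD, natrM); field.
- by apply/dvdnP; exists (3 * m * m + m)%N; ring.
Qed.

Lemma lissbE (F : numFieldType) (n : nat) : (lissb n)%:R =
  (if odd n then 3 / 4 * n%:R ^+ 2 + 3 / 2 * n%:R - 1 / 4
   else 3 / 4 * n%:R ^+ 2 + n%:R) :> F.
Proof.
rewrite /lissb; have := odd_double_half n; case: ifP => _ /= <-;
  rewrite -!mul2n -!mulnn; move: n./2 => m; apply: natr_eq_div4; rewrite divnK.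
- by rewrite natrB ?(natrD, natrM); [field | lia].
- by apply/dvdnP; exists (3 * m * m + 6 * m + 2)%N; nia.
- by rewrite !(natrD, natrM); field.
- by apply/dvdnP; exists (3 * m * m + 2 * m)%N; ring.
Qed.

Lemma lisscE (F : numFieldType) (n : nat) : (lissc n)%:R =
  (if odd n then 3 / 4 * n%:R ^+ 2 + 3 / 2 * n%:R + 3 / 4
   else 3 / 4 * n%:R ^+ 2 + 3 / 2 * n%:R + 1) :> F.
Proof.
rewrite /lissc; have := odd_double_half n; case: ifP => _ /= <-;
  rewrite -!mul2n -!mulnn; move: n./2 => m; apply: natr_eq_div4; rewrite divnK.
- by rewrite !(natrD, natrM); field.
- by apply/dvdnP; exists (3 * m * m + 6 * m + 3)%N; ring.
- by rewrite !(natrD, natrM); field.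
- by apply/dvdnP; exists (3 * m * m + 3 * m + 1)%N; ring.
Qed.

Definition nu (n : nat) : nat :=
  (n * maxn (lissa n) (maxn (lissb n) (lissc n)))%N.

(* Chebyshev-Gauss: the mu + 1 zeros of T_(mu + 1).
   Chebyshev-Lobatto: the mu + 1 extrema of T_mu, endpoints included. *)
Inductive cheb_rule := Gauss | Lobatto.

Definition mu (q : cheb_rule) (n : nat) : nat :=
  match q with Gauss => nu n | Lobatto => (nu n).+1 end.

Section Defs.
Variable R : realType.
Implicit Types (m n i j k s : nat) (q : cheb_rule).

Definition theta q n s : R :=
  match q with
  | Gauss => (2 * s + 1)%:R * pi / (2 * mu q n + 2)%:R
  | Lobatto => s%:R * pi / (mu q n)%:R
  end.

Definition omega q n s : R :=
  match q with
  | Gauss => pi / (mu q n + 1)%:R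
  | Lobatto => if (s == 0%N) || (s == mu q n) then pi / (2 * mu q n)%:R
               else pi / (mu q n)%:R
  end.

Definition weight q n s : R := pi ^+ 2 * omega q n s.

Definition tau q n s : R := cos (theta q n s).

(* Meaningful for t in [-1, 1]. *)
Definition chebT m (t : R) : R := cos (m%:R * acos t).

Definition sigma m : R := Num.sqrt ((1 + Num.sg m%:R) / pi).

Definition chebTn m (t : R) : R := sigma m * chebT m t.

Definition point3 (x y z : R) : 'rV[R]_3 := \row_(l < 3) [:: x; y; z]`_l.

Definition cube : set 'rV[R]_3 := [set x | forall l, -1 <= x ord0 l <= 1].

Definition phi i j k (x : 'rV[R]_3) : R :=
  chebTn i (x ord0 (inord 0)) * chebTn j (x ord0 (inord 1)) *
  chebTn k (x ord0 (inord 2)).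

Definition lissajous n (t : R) : 'rV[R]_3 :=
  point3 (cos ((lissa n)%:R * t)) (cos ((lissb n)%:R * t))
         (cos ((lissc n)%:R * t)).

Definition hyper_coef q n (f : 'rV[R]_3 -> R) i j k : R :=
  \sum_(s < (mu q n).+1) weight q n s * f (lissajous n (theta q n s)) *
    phi i j k (lissajous n (theta q n s)).

Definition cheb_coef q n (g : R -> R) m : R :=
  \sum_(s < (mu q n).+1) omega q n s * chebTn m (tau q n s) * g (tau q n s).

End Defs.

Arguments cube : clear implicits.

(* Main.v *)
(** Pulled back to the parameter theta, every Chebyshev polynomial becomes a
    cosine: T_m(cos theta) = cos(m theta). The product of three cosines that
    phi_(i,j,k) becomes along the curve is, by applying the product-to-sum
    formula twice, the average of the cosines of frequencies
    alpha_1, ..., alpha_4, and all four are at most nu, so that they are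
    covered by the discrete coefficients gamma. The identity then holds node
    by node, whatever the nodes and the weights of the quadrature are. *)
Require Import Defs.
From HB Require Import structures.
From mathcomp Require Import all_boot all_order all_algebra.
From mathcomp Require Import all_classical all_reals all_analysis.
From mathcomp Require Import ring zify.

Import Order.TTheory GRing.Theory Num.Theory.
Import numFieldNormedType.Exports.

Local Open Scope ring_scope.
Local Open Scope classical_set_scope.

Lemma lissa_gt0 (n : nat) : (0 < n)%N -> (0 < lissa n)%N.
Proof. by rewrite /lissa; case: ifP => on n0; rewrite divn_gt0 //; nia. Qed.

Lemma lissb_gt0 (n : nat) : (0 < n)%N -> (0 < lissb n)%N.
Proof. by rewrite /lissb; case: ifP => on n0; rewrite divn_gt0 //; nia. Qed.

Lemma lissc_gt0 (n : nat) : (0 < n)%N -> (0 < lissc n)%N.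
Proof. by rewrite /lissc; case: ifP => on n0; rewrite divn_gt0 //; nia. Qed.

Section Chebyshev.
Variable R : realType.
Implicit Types (m p n i j k s : nat) (q : cheb_rule) (x : R).

Lemma sigma_gt0 m : 0 < sigma R m.
Proof.
by rewrite /sigma sqrtr_gt0 divr_gt0 ?pi_gt0// ltr_pwDl// sgr_ge0.
Qed.

(** [sigma] depends only on whether its index vanishes. This is why the normalizations at
    [i * lissa n], etc. agree with those of the basis at [i], [j], [k]. *)
Lemma sigmaMr m p : (0 < p)%N -> sigma R (m * p) = sigma R m.
Proof.
by move=> p0; rewrite /sigma natrM sgrM [Num.sg p%:R]gtr0_sg ?ltr0n// mulr1.
Qed.

Lemma cos_mulSS m x :
  cos (m.+2%:R * x) = 2 * cos x * cos (m.+1%:R * x) - cos (m%:R * x).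
Proof.
have -> : m.+2%:R * x = m.+1%:R * x + x by ring.
have -> : m%:R * x = m.+1%:R * x - x by ring.
by rewrite cosB cosD; ring.
Qed.

(** As [acos (cos x)] need not be [x] outside $[0,\pi]$, the angle cannot be simplified directly;
    the three-term recurrence determines both sides from [cos x] alone. *)
Lemma chebT_cos m x : chebT m (cos x) = cos (m%:R * x).
Proof.
have cx : cos (acos (cos x)) = cos x.
  by rewrite acosK// in_itv/= cos_geN1 cos_le1.
rewrite /chebT; elim/ltn_ind: m => -[|[|m]] IH; rewrite ?mul0r ?mul1r//.
by rewrite !cos_mulSS cx !IH.
Qed.

Lemma cos_abszB m p x :
  cos (`|(m%:Z - p%:Z)%R|%N%:R * x) = cos (m%:R * x - p%:R * x).
Proof.
have [pm|/ltnW mp] := leqP p m.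
  by rewrite distnEl// natrB// mulrBl.
by rewrite distnEr// natrB// mulrBl -cosN opprB.
Qed.

Lemma cosM_nat m p x : cos (m%:R * x) * cos (p%:R * x) =
  (cos ((m + p)%:R * x) + cos (`|(m%:Z - p%:Z)%R|%N%:R * x)) / 2.
Proof. by rewrite cos_abszB natrD (mulrDl _ _ x) cosB cosD; field. Qed.

Lemma point3_chebT_cos n x :
  point3 (chebT (lissa n) (cos x)) (chebT (lissb n) (cos x))
         (chebT (lissc n) (cos x)) = lissajous n x.
Proof. by rewrite !chebT_cos. Qed.

Lemma phi_lissajous n i j k x : phi i j k (lissajous n x) =
  sigma R i * sigma R j * sigma R k *
  (cos ((i * lissa n)%:R * x) * cos ((j * lissb n)%:R * x) *
   cos ((k * lissc n)%:R * x)).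
Proof.
rewrite /phi /chebTn !mxE !inordK//= !chebT_cos !natrM !mulrA; ring.
Qed.

(** Dividing by [sigma R m] cancels the normalization of $\hat T_m$, leaving bare cosines that can
    be added node by node. *)
Lemma cheb_coef_div_sigma q n (f : 'rV[R]_3 -> R) m :
  cheb_coef q n (fun t => f (point3 (chebT (lissa n) t) (chebT (lissb n) t)
                                    (chebT (lissc n) t))) m / sigma R m =
  \sum_(s < (mu q n).+1) omega R q n s * cos (m%:R * theta R q n s) *
    f (lissajous n (theta R q n s)).
Proof.
rewrite /cheb_coef mulr_suml; apply: eq_bigr => s _.
rewrite /tau point3_chebT_cos /chebTn chebT_cos.
by field; rewrite gt_eqF ?sigma_gt0.
Qed.

End Chebyshev.

Theorem proposition2 (R : realType) (n : nat) (hn : (1 <= n)%N)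
  (f : 'rV[R]_3 -> R) (hf : {within cube R, continuous f})
  (q : cheb_rule) (gamma : nat -> R)
  (hgamma : forall m : nat, (m <= nu n)%N ->
     gamma m = cheb_coef q n
       (fun t : R => f (point3 (chebT (lissa n) t) (chebT (lissb n) t)
                               (chebT (lissc n) t))) m)
  (i j k : nat) (hijk : (i + j + k <= n)%N) :
  let A := (i * lissa n)%N in
  let B := (j * lissb n)%N in
  let C := (k * lissc n)%N in
  let alpha1 := (A + B + C)%N in
  let alpha2 := `|(A%:Z + B%:Z - C%:Z)%R|%N in
  let alpha3 := (`|(A%:Z - B%:Z)%R|%N + C)%N in
  let alpha4 := `|(`|(A%:Z - B%:Z)%R|%N%:Z - C%:Z)%R|%N in
  hyper_coef q n f i j k =
    pi ^+ 2 / 4 * (sigma R A * sigma R B * sigma R C) *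
    (gamma alpha1 / sigma R alpha1 + gamma alpha2 / sigma R alpha2 +
     gamma alpha3 / sigma R alpha3 + gamma alpha4 / sigma R alpha4).
Proof.
move=> A B C alpha1 alpha2 alpha3 alpha4.
(* [alpha1] is the largest of the four frequencies, and it is at most
   $(i+j+k)\max(a_n,b_n,c_n)\le\nu$. *)
have bound m : (m <= alpha1)%N -> (m <= nu n)%N.
  move/leq_trans; apply; rewrite /nu; set M := maxn _ _.
  apply: leq_trans (leq_mul hijk (leqnn M)).
  by rewrite !mulnDl !leq_add// leq_mul2l /M !leq_max leqnn ?orbT.
rewrite !hgamma; [|by apply: bound; lia ..].
rewrite !cheb_coef_div_sigma -!big_split /= mulr_sumr.
apply: eq_bigr => s _; rewrite phi_lissajous /weight.
rewrite !sigmaMr ?lissa_gt0 ?lissb_gt0 ?lissc_gt0// -/A -/B -/C.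
set x := theta R q n s.
have -> : cos (A%:R * x) * cos (B%:R * x) * cos (C%:R * x) =
    (cos (alpha1%:R * x) + cos (alpha2%:R * x) +
     cos (alpha3%:R * x) + cos (alpha4%:R * x)) / 4.
  (* The first product-to-sum gives frequencies $A+B$ and $|A-B|$; pairing each with $C$ gives
     [alpha1], [alpha2] and [alpha3], [alpha4]. *)
  by rewrite cosM_nat mulrAC mulrDl !cosM_nat PoszD; field.
by field.
Qed.
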